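(* Let $s$ and $t$ be relatively prime positive integers, and let $X$ denote the size of a partition chosen uniformly at random from the set of $(s,t)$-core partitions. Then the third moment of $X$ about its mean is $$\mathbf{E}\big[(X-\mathbf{E}[X])^3\big]=\frac{1}{60480}\, s\,t\,(t-1)(s-1)(s+t+1)(s+t)\,\big(2s^2t+2st^2-3s^2-3st-3t^2-3\big).$$
   Context: A partition is a non-increasing finite sequence of positive integers $\lambda=(\lambda_1,\dots,\lambda_k)$, $k\ge 0$ (the empty partition is allowed); its size is $\lambda_1+\dots+\lambda_k$. Its Ferrers diagram consists of the cells $(i,j)$ with $1\le i\le k$, $1\le j\le\lambda_i$. The hook length of cell $(i,j)$ is $\lambda_i-j+\lambda'_j-i+1$, where $\lambda'$ is the conjugate partition ($\lambda'_j$ = number of $i$ with $\lambda_i\ge j$). A partition is an $s$-core if no cell has hook length equal to $s$, and an $(s,t)$-core partition if it is simultaneously an $s$-core and a $t$-core. For coprime $s,t$ the set of $(s,t)$-core partitions is finite, and it is given the uniform probability distribution. *)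

(* Defs.v *)
From HB Require Import structures.
From mathcomp Require Import all_boot all_order all_algebra finmap zify.
From mathcomp Require Import boolp classical_sets functions cardinality.

Set Implicit Arguments.
Unset Strict Implicit.
Unset Printing Implicit Defensive.

Import Order.TTheory GRing.Theory Num.Theory.

Local Open Scope classical_set_scope.

Definition is_partition (la : seq nat) : bool :=
  sorted geq la && all (fun x => 0 < x) la.

Record intpart : Type := IntPart {
  parts :> seq nat;
  _ : is_partition parts }.

HB.instance Definition _ := [isSub for parts].
HB.instance Definition _ := [Countable of intpart by <:].

Definition psize (la : intpart) : nat := sumn la.

(* Rows and columns are numbered from 1; [part la i] is 0 past the last row. *)
Definition part (la : intpart) (i : nat) : nat := nth 0 la i.-1.

Definition conj_part (la : intpart) (j : nat) : nat :=
  count (fun x => j <= x) la.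

Definition in_diagram (la : intpart) (i j : nat) : Prop :=
  1 <= i <= size la /\ 1 <= j <= part la i.

(* For cells of the diagram [j <= part la i] and [i <= conj_part la j], so
   neither subtraction is truncated. *)
Definition hook_length (la : intpart) (i j : nat) : nat :=
  (part la i - j) + (conj_part la j - i) + 1.

Definition is_core (s : nat) (la : intpart) : Prop :=
  forall i j, in_diagram la i j -> hook_length la i j <> s.

Definition cores (s t : nat) : set intpart :=
  [set la | is_core s la /\ is_core t la].

(* Expectation of [f] under the uniform distribution on the finite set [A].
   [fset_set A] is the finite set with the same elements as [A] when [A] is
   finite; see [finite_cores] below for the sets used here. *)
Definition expect (T : choiceType) (A : set T) (f : T -> rat) : rat :=
  ((\sum_(x <- fset_set A) f x) / (#|` fset_set A|)%:R)%R.

Section FinitelyManyCores.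

Implicit Types (la : intpart) (s t i j b : nat).

Lemma part_gt0 la i : 1 <= i <= size la -> 0 < part la i.
Proof.
move=> /andP[i1 ik]; have /andP[_ /allP P] := valP la.
by apply: P; apply: mem_nth; rewrite prednK.
Qed.

Lemma part_mono la i i' : 1 <= i -> i <= i' -> part la i' <= part la i.
Proof.
move=> i1 ii'; have /andP[S _] := valP la; rewrite /part.
have [k|k] := leqP (size la) i'.-1; first by rewrite nth_default.
have gt : transitive geq by move=> a b c /= h1 h2; apply: leq_trans h2 h1.
have gr : reflexive geq by move=> a /=.
have ii : i.-1 <= i'.-1 by lia.
by apply: (sorted_leq_nth gt gr 0 S) => //; rewrite inE (leq_ltn_trans ii).
Qed.

Lemma conj_partE la j r : 0 < j -> r <= size la ->
  (0 < r -> j <= part la r) -> part la r.+1 < j -> conj_part la j = r.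
Proof.
move=> j0 rk h1 h2; rewrite /conj_part -(cat_take_drop r la) count_cat.
have -> : count (fun x => j <= x) (take r la) = r.
  rewrite -[RHS](size_takel rk); apply/eqP; rewrite -all_count.
  apply/(all_nthP 0) => i; rewrite size_takel // => ir.
  rewrite nth_take //; apply: leq_trans (h1 _) _; first lia.
  by have := @part_mono la i.+1 r isT ir.
have -> : count (fun x => j <= x) (drop r la) = 0; last by rewrite addn0.
apply/eqP; rewrite -leqn0 leqNgt -has_count -all_predC.
apply/(all_nthP 0) => i _; rewrite nth_drop /= -ltnNge.
apply: leq_ltn_trans h2.
by have := @part_mono la r.+1 (r + i).+1 isT; apply; lia.
Qed.

(* The hook length of the first cell of row [i]. *)
Definition beta la i := part la i + size la - i.

Definition in_beta la b := exists2 i, 1 <= i <= size la & b = beta la i.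

Lemma in_betaB s la b : is_core s la -> in_beta la b -> s <= b ->
  in_beta la (b - s).
Proof.
move=> core [i hi ->] sb; apply: contrapT => nb.
have cst i' : 1 <= i' <= size la -> beta la i' <> beta la i - s.
  by move=> h e; apply: nb; exists i'.
have exr : exists r, (i <= r <= size la) && (beta la i - s <= beta la r).
  by exists i; rewrite leqnn; lia.
have ubr r : (i <= r <= size la) && (beta la i - s <= beta la r) ->
  r <= size la by lia.
have [r /andP[hr br] mx] := ex_maxnP exr ubr.
have {br}br : beta la i - s < beta la r by have := cst r; lia.
have nx : part la r.+1 + size la <= beta la i - s + r.
  have [e|e] := ltnP r (size la); last first.
    by have -> : part la r.+1 = 0 by [rewrite /part nth_default|]; lia.
  have := mx r.+1; rewrite /beta in br *; lia.
pose j := beta la i - s + r + 1 - size la.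
have jE : j = beta la i - s + r + 1 - size la by [].
have P := @part_mono la i r; rewrite /beta in br nx jE sb.
have j0 : 0 < j by lia.
have jr : j <= part la r by lia.
have cj : conj_part la j = r.
  by apply: conj_partE; lia.
apply: (core i j); first by split => //; lia.
by rewrite /hook_length cj; lia.
Qed.

Lemma in_beta_bound s t la b : 0 < s -> 0 < t -> coprime s t ->
  cores s t la -> in_beta la b -> b < s * t.
Proof.
move=> s0 t0 st [cs ct] hb; rewrite ltnNge; apply/negP => ge.
have dec u x c : is_core u la -> in_beta la (c + x * u) -> in_beta la c.
  move=> cu; elim: x => [|x IH]; first by rewrite addn0.
  move=> /(in_betaB cu) h; apply: IH.
  have -> : c + x * u = c + x.+1 * u - u by rewrite mulSn; lia.
  by apply: h; rewrite mulSn; lia.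
have n0 : ~ in_beta la 0.
  by move=> [i hi]; have := part_gt0 hi; rewrite /beta; lia.
have [x [y' e]] : exists x y', b = 0 + x * s + y' * t.
  have [u v e _] := egcdnP s t0; rewrite gcdnC (eqP st) in e.
  pose y := (b * u) %% s.
  have ym : y * t = b %[mod s].
    by rewrite /y modnMml -mulnA e mulnDr muln1 mulnA modnMDl.
  have yb : y * t <= b.
    apply: leq_trans ge; rewrite leq_mul2r; apply/orP; right.
    by apply: ltnW; rewrite ltn_mod.
  have /dvdnP[x ex] : s %| b - y * t by rewrite -eqn_mod_dvd // ym.
  by exists x, y; lia.
by apply: n0; apply: (dec s x) => //; apply: (dec t y') => //; rewrite -e.
Qed.

Lemma finite_cores s t : 0 < s -> 0 < t -> coprime s t ->
  finite_set (cores s t).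
Proof.
move=> s0 t0 st; pose N := s * t.
have p0 : is_partition [::] by [].
pose g (f : N.-tuple 'I_N.+1) : intpart :=
  insubd (IntPart p0) [seq x <- [seq val y | y <- f] | 0 < x].
apply: (@sub_finite_set _ _ (g @` [set: N.-tuple 'I_N.+1])); last first.
  by apply: finite_image; apply: finite_finset.
move=> la hla.
have bd i : 1 <= i <= size la -> part la i + size la - i < N.
  by move=> hi; apply: in_beta_bound hla _ => //; exists i.
have kN : size la <= N.
  case: (posnP (size la)) => [->//|k0].
  by have := bd 1; have := @part_gt0 la 1; lia.
have pN i : part la i <= N.
  have [h|h] := boolP (1 <= i <= size la); first by have := bd _ h; lia.
  case: i h => [|i] h; last by rewrite /part nth_default //=; lia.
  case: (posnP (size la)) => k0; first by rewrite /part nth_default // k0.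
  by have := bd 1; rewrite /part /=; lia.
exists [tuple inord (part la i.+1) | i < N] => //.
apply: val_inj; rewrite /g val_insubd.
suff -> : [seq x <- [seq val y | y <-
    [tuple (inord (part la i.+1) : 'I_N.+1) | i < N]] | 0 < x] = la.
  by rewrite (valP la).
have -> : [seq val y | y <- [tuple (inord (part la i.+1) : 'I_N.+1) | i < N]]
    = la ++ nseq (N - size la) 0.
  apply: (@eq_from_nth _ 0) => [|i].
    by rewrite size_map size_tuple size_cat size_nseq; lia.
  rewrite size_map size_tuple => iN.
  rewrite (nth_map ord0) ?size_tuple // -[i]/(val (Ordinal iN)).
  rewrite -tnth_nth tnth_mktuple /= inordK ?ltnS ?pN // nth_cat /part /=.
  by case: ltnP => // ?; rewrite nth_nseq if_same nth_default.
have /andP[_ /all_filterP P] := valP la.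
by rewrite filter_cat P filter_nseq /= cats0.
Qed.

End FinitelyManyCores.

(* Main.v *)
(** Put [N = s + t]. The set [M] consisting of the negative integers and of
    the first-column hook lengths of an [(s, t)]-core is closed under
    subtracting [s] and [t]. Call [p] a corner if [p] is not in [M] and
    [p - N] is; every class modulo [N] contains exactly one corner, and from a
    corner [p] one reaches the corner [p + s] if [p - t] is in [M], and the
    corner [p - t] otherwise. Following these steps [N] times is a closed walk
    through all corners, with [t] steps [+s] and [s] steps [-t]. Conversely
    every word in these steps comes from exactly one pair (core, corner), so
    the uniform distribution on cores is the image of that on words.
    The corners at which a step [+s] starts determine the size of the core,
    which is [(s^2 - 1) (t^2 - 1) / 24] minus half the number of occurrences of
    the two alternating words of length 4 as subwords of the word.
    A product of two subword counts is a sum of subword counts, indexed by the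
    infiltration product, and the mean number of occurrences of a subword with
    [a] letters [+s] and [b] letters [-t] is
    [t (t - 1) .. (t - a + 1) s (s - 1) .. (s - b + 1) / (a + b)!]; hence the
    moments of the size are read off from the infiltration powers of the sum
    of the two alternating words. *)

Require Import Defs.
From mathcomp Require Import all_boot all_order all_algebra finmap zify ring.
From mathcomp Require Import boolp classical_sets cardinality.

Set Implicit Arguments.
Unset Strict Implicit.
Unset Printing Implicit Defensive.

Import Order.TTheory GRing.Theory Num.Theory.

Local Open Scope ring_scope.

(** * Averages over a sequence *)

Section Mean.

Variable R : numFieldType.

Definition mean (I : Type) (r : seq I) (f : I -> R) : R :=
  (\sum_(x <- r) f x) / (size r)%:R.

Lemma eq_mean (I : Type) (r : seq I) (f g : I -> R) :
  f =1 g -> mean r f = mean r g.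
Proof. by move=> fg; rewrite /mean (eq_bigr _ (fun x _ => fg x)). Qed.

Lemma eq_in_mean (I : eqType) (r : seq I) (f g : I -> R) :
  {in r, f =1 g} -> mean r f = mean r g.
Proof. by move=> fg; rewrite /mean (eq_big_seq _ fg). Qed.

Lemma perm_mean (I : eqType) (r1 r2 : seq I) (f : I -> R) :
  perm_eq r1 r2 -> mean r1 f = mean r2 f.
Proof. by move=> r12; rewrite /mean (perm_big _ r12) (perm_size r12). Qed.

Lemma mean_cst (I : Type) (r : seq I) (c : R) :
  size r != 0%N -> mean r (fun=> c) = c.
Proof.
move=> r0; rewrite /mean big_const_seq count_predT iter_addr_0.
by rewrite -[c *+ _]mulr_natr mulfK // pnatr_eq0.
Qed.

Lemma meanD (I : Type) (r : seq I) (f g : I -> R) :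
  mean r (fun x => f x + g x) = mean r f + mean r g.
Proof. by rewrite /mean big_split mulrDl. Qed.

Lemma meanZ (I : Type) (r : seq I) (c : R) (f : I -> R) :
  mean r (fun x => c * f x) = c * mean r f.
Proof. by rewrite /mean -big_distrr mulrA. Qed.

Lemma central_moment3_affine (I : Type) (r : seq I) (f : I -> R) (a b : R)
    (g := fun x => a + b * f x) (m := fun k => mean r (fun x => f x ^+ k)) :
    size r != 0%N ->
  mean r (fun x => (g x - mean r g) ^+ 3) =
  b ^+ 3 * (m 3 - 3 * m 1 * m 2 + 2 * m 1 ^+ 3).
Proof.
move=> r0; have -> : mean r g = a + b * m 1%N.
  by rewrite meanD mean_cst // meanZ.
have expand x : (a + b * f x - (a + b * m 1%N)) ^+ 3 =
    b ^+ 3 * (f x ^+ 3 + ((- 3 * m 1%N) * f x ^+ 2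
      + (3 * m 1%N ^+ 2 * f x ^+ 1 + - m 1%N ^+ 3))) by ring.
rewrite (eq_mean _ expand) meanZ !meanD !meanZ mean_cst //.
by rewrite -/(m 1%N) -/(m 2%N) -/(m 3%N); ring.
Qed.

Lemma mean_allpairs_dep (I J : eqType) (K : Type) (r : seq I) (t : I -> seq J)
    (h : I -> J -> K) (n : nat) (f : K -> R) :
  {in r, forall i, size (t i) = n} ->
  mean [seq h i j | i <- r, j <- t i] f =
  mean r (fun i => mean (t i) (fun j => f (h i j))).
Proof.
move=> tn.
have /all_pred1P sizes : all (pred1 n) [seq size (t i) | i <- r].
  by apply/allP => _ /mapP[i /tn <- ->] /=.
have size_rn : size [seq h i j | i <- r, j <- t i] = (size r * n)%N.
  by rewrite size_allpairs_dep sizes sumn_nseq size_map mulnC.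
rewrite [RHS](eq_in_mean (g := fun i => (\sum_(j <- t i) f (h i j)) / n%:R)).
  rewrite /mean size_rn big_allpairs_dep -big_distrl /= natrM invfM mulrA.
  by rewrite mulrAC.
by move=> i /tn tin; rewrite /mean tin.
Qed.

End Mean.

(** * Words in two letters *)

Section Words.

Implicit Types (i j : nat) (w : seq bool).

Definition words i j : seq (seq bool) :=
  permutations (nseq i true ++ nseq j false).

Lemma mem_words i j w :
  (w \in words i j) = (count_mem true w == i) && (count_mem false w == j).
Proof.
rewrite mem_permutations; apply/idP/andP => [/permP eq_w|[/eqP wi /eqP wj]].
  by rewrite !eq_w !count_cat !count_nseq /= !mul0n !mul1n addn0 !eqxx.
by apply/allP => -[] _ /=; rewrite count_cat !count_nseq ?wi ?wj /=; lia.
Qed.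

Lemma words_uniq i j : uniq (words i j).
Proof. exact: permutations_uniq. Qed.

Lemma mem_map_cons (T : eqType) (a : T) (s : seq (seq T)) (u : seq T) :
  (u \in map (cons a) s) = if u is b :: v then (b == a) && (v \in s) else false.
Proof.
case: u => [|b v]; first by apply/mapP => -[].
have cons_inj : injective (cons a) by move=> u1 u2 [].
case: eqVneq => [->|ba]; first by rewrite mem_map.
by apply/mapP => -[u _ [eq_ba _]]; rewrite eq_ba eqxx in ba.
Qed.

Lemma perm_words_cons i j : (0 < i + j)%N ->
  perm_eq (words i j)
    ((if i is i'.+1 then map (cons true) (words i' j) else [::]) ++
     (if j is j'.+1 then map (cons false) (words i j') else [::])).
Proof.
move=> ij; apply: uniq_perm => [||w]; first exact: words_uniq.
  have cons_inj (b : bool) : injective (cons b) by move=> u v [].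
  rewrite cat_uniq; case: i j {ij} => [|i] [|j];
    rewrite ?map_inj_uniq ?words_uniq ?andbT //=;
    by apply/hasPn => _ /mapP[u _ ->] //; rewrite mem_map_cons.
rewrite mem_cat mem_words; case: i j ij => [|i] [|j] // _;
  rewrite ?mem_map_cons; case: w => [|[] w] //=;
  by rewrite ?mem_words ?in_nil ?add0n ?add1n ?eqSS ?andbF ?orbF.
Qed.

Lemma size_words i j : size (words i j) = 'C(i + j, i).
Proof.
have [n] := ubnP (i + j); elim: n => // n IHn in i j *; rewrite ltnS => ijn.
have [ij|] := posnP (i + j); last first.
  move=> ij; rewrite (perm_size (perm_words_cons ij)) size_cat.
  case: i j ij ijn => [|i] [|j] // _; rewrite ?size_map => ijn;
    rewrite ?IHn ?addn0 ?add0n ?binn ?bin0 //; try lia.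
  by rewrite -addSnnS addSn binS addnC addnS.
by have [-> ->] : i = 0%N /\ j = 0%N by lia.
Qed.

Lemma size_words_neq0 i j : size (words i j) != 0%N.
Proof. by rewrite size_words -lt0n bin_gt0 leq_addr. Qed.

Lemma mean_words_cons (R : numFieldType) i j (f : seq bool -> R) :
  (i + j)%:R * mean (words i j) f =
  i%:R * mean (words i.-1 j) (fun w => f (true :: w)) +
  j%:R * mean (words i j.-1) (fun w => f (false :: w)).
Proof.
have [ij|ij] := posnP (i + j).
  have [-> ->] : i = 0%N /\ j = 0%N by lia.
  by rewrite !mul0r addr0.
have bin_neq0 k l : 'C(k + l, k)%:R != 0 :> R.
  by rewrite -size_words pnatr_eq0 size_words_neq0.
have sumE k l (g : seq bool -> R) :
    \sum_(w <- words k l) g w = 'C(k + l, k)%:R * mean (words k l) g.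
  by rewrite /mean size_words mulrC divfK.
apply: (mulfI (bin_neq0 i j)).
rewrite mulrCA -sumE (perm_big _ (perm_words_cons ij)) big_cat !mulrDr /=.
congr (_ + _).
  case: i {ij} => [|i]; first by rewrite big_nil !(mul0r, mulr0).
  rewrite big_map sumE !mulrA -!natrM; congr (_%:R * _ / _).
  by rewrite -[(i + j)%N]/((i.+1 + j).-1) mul_bin_diag mulnC.
case: j {ij} => [|j]; first by rewrite big_nil !(mul0r, mulr0).
rewrite big_map sumE !mulrA -!natrM; congr (_%:R * _ / _).
have := mul_bin_down (i + j.+1) i; rewrite addKn addnS /= => ->.
by rewrite mulnC.
Qed.

End Words.

(** * Counting subwords *)

Fixpoint subcount (u w : seq bool) : nat :=
  if u is a :: u' then
    (fix count w := if w is b :: w' then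
       (count w' + (a == b) * subcount u' w')%N else 0%N) w
  else 1%N.

Lemma subcount_cons a u b w :
  subcount (a :: u) (b :: w) =
  (subcount (a :: u) w + (a == b) * subcount u w)%N.
Proof. by []. Qed.

(* A polynomial with natural coefficients in two noncommuting letters: the
   constant coefficient and the two left quotients by the letters. *)
Inductive wpoly : Type := WZero | WNode of nat & wpoly & wpoly.

Definition wconst (P : wpoly) : nat := if P is WNode c _ _ then c else 0%N.

Definition wquot (b : bool) (P : wpoly) : wpoly :=
  if P is WNode _ Pt Pf then if b then Pt else Pf else WZero.

Fixpoint wadd (P Q : wpoly) : wpoly :=
  match P, Q with
  | WZero, _ => Q
  | _, WZero => P
  | WNode c Pt Pf, WNode d Qt Qf => WNode (c + d) (wadd Pt Qt) (wadd Pf Qf)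
  end.

Fixpoint infiltration (P : wpoly) : wpoly -> wpoly :=
  if P is WNode c Pt Pf then
    fix infil Q :=
    if Q is WNode d Qt Qf then
      WNode (c * d)
        (wadd (wadd (infiltration Pt Q) (infil Qt)) (infiltration Pt Qt))
        (wadd (wadd (infiltration Pf Q) (infil Qf)) (infiltration Pf Qf))
    else WZero
  else fun=> WZero.

Fixpoint wword (u : seq bool) : wpoly :=
  if u is b :: u' then
    if b then WNode 0 (wword u') WZero else WNode 0 WZero (wword u')
  else WNode 1 WZero WZero.

(* The number of subwords of [w], weighted by their coefficients in [P]. *)
Fixpoint wcount (P : wpoly) (w : seq bool) : nat :=
  if w is b :: w' then (wcount P w' + wcount (wquot b P) w')%N else wconst P.

Lemma wcount_zero w : wcount WZero w = 0%N.
Proof. by elim: w => //= b w ->. Qed.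

Lemma wcount_word u w : wcount (wword u) w = subcount u w.
Proof.
elim: w u => [|b w IHw] [|a u]; first by [].
- by case: a.
- by case: b; rewrite /= -[WNode 1 _ _]/(wword [::]) IHw wcount_zero.
rewrite subcount_cons -!IHw /=.
by case: a; case: b; rewrite /= ?wcount_zero ?mul1n.
Qed.

Lemma wconst_add P Q : wconst (wadd P Q) = (wconst P + wconst Q)%N.
Proof. by case: P Q => [|c Pt Pf] [|d Qt Qf] //=; rewrite addn0. Qed.

Lemma waddw0 P : wadd P WZero = P.
Proof. by case: P. Qed.

Lemma wquot_add b P Q : wquot b (wadd P Q) = wadd (wquot b P) (wquot b Q).
Proof. by case: P Q b => [|c Pt Pf] [|d Qt Qf] [] //=; rewrite waddw0. Qed.

Lemma wcount_add P Q w : wcount (wadd P Q) w = (wcount P w + wcount Q w)%N.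
Proof.
elim: w P Q => [|b w IHw] P Q /=; first exact: wconst_add.
by rewrite wquot_add !IHw addnACA.
Qed.

Lemma wconst_infiltration P Q :
  wconst (infiltration P Q) = (wconst P * wconst Q)%N.
Proof. by case: P Q => [|c Pt Pf] [|d Qt Qf] //=; rewrite muln0. Qed.

Lemma infiltrationw0 P : infiltration P WZero = WZero.
Proof. by case: P. Qed.

Lemma wquot_infiltration b P Q :
  wquot b (infiltration P Q) =
  wadd (wadd (infiltration (wquot b P) Q) (infiltration P (wquot b Q)))
       (infiltration (wquot b P) (wquot b Q)).
Proof.
by case: P Q b => [|c Pt Pf] [|d Qt Qf] [] //=; rewrite ?infiltrationw0.
Qed.

(* Reading a letter [b] replaces [P] by [P + wquot b P], and this operation is
   multiplicative for the infiltration product. *)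
Lemma wcount_infiltration P Q w :
  wcount (infiltration P Q) w = (wcount P w * wcount Q w)%N.
Proof.
elim: w P Q => [|b w IHw] P Q /=; first exact: wconst_infiltration.
by rewrite wquot_infiltration !wcount_add !IHw; ring.
Qed.

Section ExpectedSubcount.

Variable R : numFieldType.

Implicit Types (x y : R) (f g : nat -> nat -> R) (P : wpoly).

Fixpoint ffactr (x : R) (k : nat) : R :=
  if k is k'.+1 then ffactr x k' * (x - k'%:R) else 1.

Lemma ffactrS x k : x * ffactr (x - 1) k = ffactr x k.+1.
Proof.
elim: k => [|k IHk]; first by rewrite /= subr0 mulrC.
by rewrite /= mulrA IHk /= -natr1; ring.
Qed.

Lemma ffactr0 k : ffactr 0 k.+1 = 0.
Proof. by rewrite -ffactrS mul0r. Qed.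

Lemma natr_fact n : n`!%:R = ffactr n%:R n.
Proof.
elim: n => // n IHn; rewrite -ffactrS -natr1 addrK -IHn natr1.
by rewrite factS natrM.
Qed.

Definition expected_subcount x y (a b : nat) : R :=
  ffactr x a * ffactr y b / ((a + b)`!)%:R.

Lemma expected_subcount_consl x y a b :
  x * expected_subcount (x - 1) y a b =
  (a + b).+1%:R * expected_subcount x y a.+1 b.
Proof.
rewrite /expected_subcount -ffactrS addSn factS natrM; field.
by rewrite -natrD nat1r !pnatr_eq0 -lt0n fact_gt0.
Qed.

Lemma expected_subcount_consr x y a b :
  y * expected_subcount x (y - 1) a b =
  (a + b).+1%:R * expected_subcount x y a b.+1.
Proof.
rewrite /expected_subcount -ffactrS addnS factS natrM; field.
by rewrite -natrD nat1r !pnatr_eq0 -lt0n fact_gt0.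
Qed.

Lemma expected_subcount_skip x y a b :
  x * expected_subcount (x - 1) y a b + y * expected_subcount x (y - 1) a b =
  (x + y - (a + b)%:R) * expected_subcount x y a b.
Proof.
transitivity ((x * ffactr (x - 1) a * ffactr y b
    + ffactr x a * (y * ffactr (y - 1) b)) / ((a + b)`!)%:R).
  by rewrite /expected_subcount; ring.
by rewrite !ffactrS /expected_subcount natrD /=; ring.
Qed.

Fixpoint content_sum (f : nat -> nat -> R) (P : wpoly) : R :=
  if P is WNode c Pt Pf then
    f 0%N 0%N *+ c + content_sum (fun a b => f a.+1 b) Pt
      + content_sum (fun a b => f a b.+1) Pf
  else 0.

Lemma eq_content_sum f g P :
  (forall a b, f a b = g a b) -> content_sum f P = content_sum g P.
Proof.
elim: P f g => //= c Pt IHt Pf IHf f g fg.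
by rewrite fg (IHt _ (fun a b => g a.+1 b)) ?(IHf _ (fun a b => g a b.+1)).
Qed.

Lemma content_sumD f g P :
  content_sum (fun a b => f a b + g a b) P = content_sum f P + content_sum g P.
Proof.
elim: P f g => /= [|c Pt IHt Pf IHf] f g; first by rewrite addr0.
by rewrite IHt IHf mulrnDl; ring.
Qed.

Lemma content_sumZ k f P :
  content_sum (fun a b => k * f a b) P = k * content_sum f P.
Proof.
elim: P f => /= [|c Pt IHt Pf IHf] f; first by rewrite mulr0.
by rewrite IHt IHf -mulrnAr !mulrDr.
Qed.

Lemma content_sum_quot x y P :
  content_sum (fun a b => (a + b)%:R * expected_subcount x y a b) P =
  x * content_sum (expected_subcount (x - 1) y) (wquot true P) +
  y * content_sum (expected_subcount x (y - 1)) (wquot false P).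
Proof.
case: P => [|c Pt Pf] /=; first by rewrite !mulr0 addr0.
rewrite mul0r mul0rn add0r -!content_sumZ.
congr (_ + _); apply: eq_content_sum => a b.
  by rewrite expected_subcount_consl addSn.
by rewrite expected_subcount_consr addnS.
Qed.

Lemma content_sum_cons x y P :
  x * (content_sum (expected_subcount (x - 1) y) P +
       content_sum (expected_subcount (x - 1) y) (wquot true P)) +
  y * (content_sum (expected_subcount x (y - 1)) P +
       content_sum (expected_subcount x (y - 1)) (wquot false P)) =
  (x + y) * content_sum (expected_subcount x y) P.
Proof.
rewrite !mulrDr addrACA -content_sum_quot -!content_sumZ -!content_sumD.
by apply: eq_content_sum => a b; rewrite expected_subcount_skip; ring.
Qed.

Lemma content_sum_const P :
  content_sum (expected_subcount 0 0) P = (wconst P)%:R.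
Proof.
case: P => //= c Pt Pf; rewrite /expected_subcount fact0 !(mul1r, divr1).
have null f Q : (forall a b, f a b = 0) -> content_sum f Q = 0.
  move=> f0; rewrite (@eq_content_sum _ (fun a b => 0 * f a b)) => [|a b].
    by rewrite content_sumZ mul0r.
  by rewrite f0 mulr0.
by rewrite !null ?addr0 // => a b; rewrite ffactr0 ?(mul0r, mulr0).
Qed.

Lemma mean_wcount i j P :
  mean (words i j) (fun w => (wcount P w)%:R) =
  content_sum (expected_subcount i%:R j%:R) P.
Proof.
have [n] := ubnP (i + j); elim: n => // n IHn in i j P *; rewrite ltnS => ijn.
have [ij|ij] := posnP (i + j).
  have [-> ->] : i = 0%N /\ j = 0%N by lia.
  by rewrite content_sum_const /mean big_seq1 divr1.
have ij_neq0 : (i + j)%:R != 0 :> R by rewrite pnatr_eq0 -lt0n.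
apply: (mulfI ij_neq0); rewrite mean_words_cons natrD -content_sum_cons.
congr (_ + _).
  case: i {ij ij_neq0} ijn => [|i] ijn; first by rewrite !mul0r.
  rewrite -[in RHS]natr1 addrK -!IHn -?meanD // natr1.
  by congr (_ * _); apply: eq_mean => w; rewrite natrD.
case: j {ij ij_neq0} ijn => [|j] ijn; first by rewrite !mul0r.
rewrite -[in RHS]natr1 addrK natr1 -!IHn -?meanD; try lia.
by congr (_ * _); apply: eq_mean => w; rewrite natrD.
Qed.

End ExpectedSubcount.

(** * Contents of noncommutative polynomials *)

Fixpoint add_seq (T : Type) (add : T -> T -> T) (r1 r2 : seq T) : seq T :=
  match r1, r2 with
  | x1 :: r1', x2 :: r2' => add x1 x2 :: add_seq add r1' r2'
  | [::], _ => r2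
  | _, [::] => r1
  end.

(* Entry [b] of row [a] is the sum of the coefficients of the words with [a]
   letters [true] and [b] letters [false]. *)
Fixpoint content_table (P : wpoly) : seq (seq nat) :=
  if P is WNode c Pt Pf then
    add_seq (add_seq addn) [:: [:: c]]
      (add_seq (add_seq addn) ([::] :: content_table Pt)
         (map (cons 0%N) (content_table Pf)))
  else [::].

Section ContentTable.

Variable R : numFieldType.

Implicit Types (f : nat -> nat -> R) (t : seq (seq nat)).

Fixpoint index_sum (T : Type) (g : nat -> T -> R) (r : seq T) : R :=
  if r is x :: r' then g 0%N x + index_sum (fun k => g k.+1) r' else 0.

Definition table_sum (f : nat -> nat -> R) : seq (seq nat) -> R :=
  index_sum (fun a => index_sum (fun b c => f a b *+ c)).

Lemma eq_index_sum (T : Type) (g h : nat -> T -> R) r :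
  (forall k x, g k x = h k x) -> index_sum g r = index_sum h r.
Proof.
by elim: r g h => //= x r IHr g h gh; rewrite gh (IHr _ (fun k => h k.+1)).
Qed.

Lemma index_sum_add (T : Type) (add : T -> T -> T) (g : nat -> T -> R) r1 r2 :
  (forall k x y, g k (add x y) = g k x + g k y) ->
  index_sum g (add_seq add r1 r2) = index_sum g r1 + index_sum g r2.
Proof.
elim: r1 r2 g => [|x r1 IHr] [|y r2] g gD; rewrite /= ?add0r ?addr0 //.
by rewrite gD IHr // addrACA.
Qed.

Lemma table_sum_add f t1 t2 :
  table_sum f (add_seq (add_seq addn) t1 t2) = table_sum f t1 + table_sum f t2.
Proof.
apply: index_sum_add => a r1 r2; apply: index_sum_add => b c1 c2.
exact: mulrnDr.
Qed.

Lemma table_sum_cons0 f t :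
  table_sum f (map (cons 0%N) t) = table_sum (fun a b => f a b.+1) t.
Proof.
rewrite /table_sum; elim: t f => //= r t IHt f.
by rewrite mulr0n add0r (IHt (fun a => f a.+1)).
Qed.

Lemma content_sumE f P : content_sum f P = table_sum f (content_table P).
Proof.
elim: P f => // c Pt IHt Pf IHf f.
rewrite [RHS]table_sum_add table_sum_add table_sum_cons0 -IHf /=.
by rewrite IHt /table_sum /= !addr0 add0r addrA.
Qed.

End ContentTable.

Definition infiltration_power (P : wpoly) (k : nat) : wpoly :=
  iter k (infiltration P) (wword [::]).

Lemma wcount_infiltration_power P k w :
  wcount (infiltration_power P k) w = (wcount P w ^ k)%N.
Proof.
elim: k => [|k IHk]; first by rewrite wcount_word; case: w.
by rewrite wcount_infiltration IHk expnS.
Qed.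

(* The factorial is written with [ffactr] so that it can be evaluated in [R],
   where the numerals involved are small. *)
Lemma mean_wcountX (R : numFieldType) i j P k :
  mean (words i j) (fun w => (wcount P w)%:R ^+ k) =
  table_sum
    (fun a b => ffactr i%:R a * ffactr j%:R b / ffactr (a + b)%:R (a + b))
    (content_table (infiltration_power P k)) :> R.
Proof.
transitivity (table_sum (expected_subcount i%:R j%:R)
    (content_table (infiltration_power P k)) : R).
  rewrite -content_sumE -mean_wcount; apply: eq_mean => w.
  by rewrite wcount_infiltration_power natrX.
apply: eq_index_sum => a r; apply: eq_index_sum => b c.
by rewrite /expected_subcount natr_fact.
Qed.

(** * Moments of the number of crossings *)

(* If the letters of [w] are placed around a circle, this is the number of pairs
   of letters [true] and pairs of letters [false] that separate each other. *)
Definition crossing_count (w : seq bool) : nat :=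
  (subcount [:: true; false; true; false] w
   + subcount [:: false; true; false; true] w)%N.

Definition crossings : wpoly :=
  wadd (wword [:: true; false; true; false])
       (wword [:: false; true; false; true]).

Lemma wcount_crossings w : wcount crossings w = crossing_count w.
Proof. by rewrite wcount_add !wcount_word. Qed.

Lemma content_table_crossings1 :
  content_table (infiltration_power crossings 1) =
  [:: [:: 0; 0]; [:: 0; 0; 0]; [:: 0; 0; 2]]%N.
Proof. by vm_compute. Qed.

Lemma content_table_crossings2 :
  content_table (infiltration_power crossings 2) =
  [:: [:: 0; 0; 0]; [:: 0; 0; 0; 0; 0]; [:: 0; 0; 2; 10; 12];
      [:: 0; 0; 10; 84; 140]; [:: 0; 0; 12; 140; 280]]%N.
Proof. by vm_compute. Qed.

Lemma content_table_crossings3 :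
  content_table (infiltration_power crossings 3) =
  [:: [:: 0; 0; 0; 0];
      [:: 0; 0; 0; 0; 0; 0; 0];
      [:: 0; 0; 2; 30; 144; 252; 144];
      [:: 0; 0; 30; 780; 5040; 11040; 7632];
      [:: 0; 0; 144; 5040; 39768; 103032; 82320];
      [:: 0; 0; 252; 11040; 103032; 307440; 277200];
      [:: 0; 0; 144; 7632; 82320; 277200; 277200]]%N.
Proof. by apply/eqP; vm_compute. Qed.

Lemma central_moment3_crossings (R : numFieldType) (i j : nat)
    (I := i%:R : R) (J := j%:R : R)
    (m := fun k => mean (words i j) (fun w => (crossing_count w)%:R ^+ k) : R) :
  m 3 - 3 * m 1 * m 2 + 2 * m 1 ^+ 3 =
  - (I * J * (I - 1) * (J - 1) * (I + J + 1) * (I + J) *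
      (2 * I ^+ 2 * J + 2 * I * J ^+ 2
        - 3 * I ^+ 2 - 3 * I * J - 3 * J ^+ 2 - 3)) / 7560.
Proof.
have momentE k : m k = mean (words i j) (fun w => (wcount crossings w)%:R ^+ k).
  by apply: eq_mean => w; rewrite wcount_crossings.
rewrite !momentE !mean_wcountX content_table_crossings1.
rewrite content_table_crossings2 content_table_crossings3.
(* [/=] would expand the entries of the tables in unary. *)
lazy [table_sum index_sum ffactr addn Nat.add].
by field.
Qed.

(** * Ideals and their corners *)

Definition step_closed (u : nat) (M : pred int) : Prop :=
  forall m, M m -> M (m - u%:Z).

Definition ideal (s t : nat) (M : pred int) : Prop :=
  [/\ step_closed s M, step_closed t M, forall m, m < 0 -> M m & ~~ M 0].

Definition corner (u : nat) (M : pred int) (p : int) : bool :=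
  ~~ M p && M (p - u%:Z).

Section Corners.

Variables s t : nat.

Local Notation N := (s + t)%N.

Implicit Types (M : pred int) (m p q : int) (n k : nat) (w : seq bool).

Definition step (b : bool) : int := if b then s%:Z else - t%:Z.

Definition next_corner M p : int := p + step (M (p - t%:Z)).

Definition corner_word M p n : seq bool :=
  [seq M (q - t%:Z) | q <- traject (next_corner M) p n].

Fixpoint walk p w : seq int :=
  if w is b :: w' then p :: walk (p + step b) w' else [::].

Lemma size_walk p w : size (walk p w) = size w.
Proof. by elim: w p => //= b w IHw p; rewrite IHw. Qed.

Lemma size_corner_word M p n : size (corner_word M p n) = n.
Proof. by rewrite size_map size_traject. Qed.

Lemma walk_corner_word M p n :
  walk p (corner_word M p n) = traject (next_corner M) p n.
Proof. by elim: n p => // n IHn p; rewrite [RHS]/= -IHn. Qed.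

Definition displacement w : int :=
  s%:Z * (count_mem true w)%:Z - t%:Z * (count_mem false w)%:Z.

Lemma displacement_cons b w : displacement (b :: w) = step b + displacement w.
Proof. by rewrite /displacement /step; case: b => /=; rewrite !PoszD; ring. Qed.

Lemma iter_next_corner M p n :
  iter n (next_corner M) p = p + displacement (corner_word M p n).
Proof.
elim: n p => [|n IHn] p; first by rewrite /displacement /=; lia.
rewrite iterSr IHn [in RHS]/corner_word /= displacement_cons.
by rewrite -/(corner_word _ _ n) [RHS]addrA.
Qed.

Lemma count_letters w :
  (count_mem true w + count_mem false w = size w)%N.
Proof. by elim: w => //= -[] w <-; rewrite !(add0n, add1n) ?addnS. Qed.

Lemma dvdz_displacement w : (N %| displacement w - (size w)%:Z * s%:Z)%Z.
Proof.
apply/dvdzP; exists (- (count_mem false w)%:Z).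
by rewrite -count_letters /displacement !PoszD; ring.
Qed.

Lemma dvdz_iter_next_corner M p n :
  (N %| iter n (next_corner M) p - (p + n%:Z * s%:Z))%Z.
Proof.
rewrite iter_next_corner opprD addrACA subrr add0r.
by rewrite -{2}(size_corner_word M p n) dvdz_displacement.
Qed.

Lemma dvdz_step b : (N %| step b - s%:Z)%Z.
Proof.
rewrite /step; case: b; first by rewrite subrr dvdz0.
by rewrite -opprD addrC -PoszD rpredN dvdzz.
Qed.

Lemma walk_shift p q w : walk (p + q) w = [seq x + q | x <- walk p w].
Proof. by elim: w p => //= b w IHw p; rewrite addrAC IHw. Qed.

Lemma mem_walk p q w : (p + q \in walk p w) = (q \in walk 0 w).
Proof.
by rewrite -[X in walk X w]add0r walk_shift (addrC p) (mem_map (addIr p)).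
Qed.

Lemma dvdz_nth_walk p w k : (k < size w)%N ->
  (N %| nth 0 (walk p w) k - (p + k%:Z * s%:Z))%Z.
Proof.
elim: w p k => // b w IHw p [|k] kw; first by rewrite mul0r addr0 subrr dvdz0.
rewrite -(rpredBr _ (dvdz_step b)) /=.
have -> : nth 0 (walk (p + step b) w) k - (p + k.+1%:Z * s%:Z) - (step b - s%:Z)
  = nth 0 (walk (p + step b) w) k - (p + step b + k%:Z * s%:Z).
  by rewrite intS; ring.
exact: IHw.
Qed.

Lemma cons_walk_ends p w :
  p :: [seq x.1 + step x.2 | x <- zip (walk p w) w] =
  rcons (walk p w) (p + displacement w).
Proof.
elim: w p => [|b w IHw] p; first by rewrite /displacement /=; congr cons; lia.
by rewrite displacement_cons addrA /= -IHw.
Qed.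

Lemma corner_word_eq M p w :
  (forall x, x \in zip (walk p w) w -> M (x.1 - t%:Z) = x.2) ->
  corner_word M p (size w) = w.
Proof.
elim: w p => //= b w IHw p Mw; have Mb := Mw _ (mem_head _ _).
rewrite /corner_word /= Mb /next_corner Mb; congr cons; apply: IHw => x xw.
by apply: Mw; rewrite inE xw orbT.
Qed.

Hypotheses (s_gt0 : (0 < s)%N) (t_gt0 : (0 < t)%N) (st_coprime : coprime s t).

Lemma coprimez_period : coprimez N s.
Proof. by rewrite coprimezE /= /coprime gcdnC gcdnDl. Qed.

Lemma exists_class_index m :
  exists2 k : nat, (k < N)%N & (N %| m - k%:Z * s%:Z)%Z.
Proof.
have [[u v] /= uv1] := coprimezP _ _ coprimez_period.
have N_gt0 : (0 < N%:Z) by lia.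
have mod_ge0 : 0 <= ((m * v) %% N)%Z by rewrite modz_ge0; lia.
have mod_ltN : ((m * v) %% N)%Z < N by exact: ltz_pmod.
exists `|((m * v) %% N)%Z|%N; first by lia.
apply/dvdzP; exists (m * u + (m * v %/ N)%Z * s).
have -> : `|((m * v) %% N)%Z|%N%:Z = ((m * v) %% N)%Z by lia.
by rewrite -{1}[m]mulr1 -uv1 /modz; ring.
Qed.

Lemma class_index_inj (k l : nat) : (k < N)%N -> (l < N)%N ->
  (N %| k%:Z * s%:Z - l%:Z * s%:Z)%Z -> k = l.
Proof.
move=> kN lN; rewrite -mulrBl Gauss_dvdzl ?coprimez_period //.
by rewrite -eqz_mod_dvd !modz_small; lia.
Qed.

Section Ideal.

Variables (M : pred int) (idealM : ideal s t M).

Lemma step_closed_period (k : nat) : step_closed (k * N) M.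
Proof.
have [closed_s closed_t _ _] := idealM; elim: k => [|k IHk] m Mm.
  by rewrite subr0.
have -> : m - (k.+1 * N)%N%:Z = m - (k * N)%N%:Z - s%:Z - t%:Z by lia.
exact/closed_t/closed_s/IHk.
Qed.

Lemma ideal_lt_corner p m : corner N M p -> (N %| m - p)%Z -> M m = (m < p).
Proof.
move=> /andP[Mp MpN] /dvdzP[c m_eq].
have [mp|pm] := ltP m p.
  have -> : m = p - N%:Z - (`|- c - 1|%N * N)%N%:Z by nia.
  exact: step_closed_period.
apply: contraNF Mp => Mm; have -> : p = m - (`|c|%N * N)%N%:Z by nia.
exact: step_closed_period.
Qed.

Lemma corner_inj p q :
  corner N M p -> corner N M q -> (N %| p - q)%Z -> p = q.
Proof.
move=> cp cq pq; have := ideal_lt_corner cq pq.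
have := ideal_lt_corner cp (_ : N %| q - p)%Z; rewrite -opprB rpredN => /(_ pq).
by case/andP: cp cq => /negPf-> _ /andP[/negPf-> _]; lia.
Qed.

Lemma corner0 : corner N M 0.
Proof.
have [_ _ neg M0] := idealM; rewrite /corner M0; apply: neg; lia.
Qed.

Lemma corner_ge0 p : corner N M p -> 0 <= p.
Proof.
have [_ _ neg _] := idealM.
by case/andP => Mp _; rewrite leNgt; apply: contra Mp; exact: neg.
Qed.

Lemma corner_next p : corner N M p -> corner N M (next_corner M p).
Proof.
have [closed_s closed_t _ _] := idealM; case/andP => Mp MpN.
rewrite /next_corner /step /corner; case: ifPn => [Mpt|Mpt].
  have -> : p + s%:Z - N%:Z = p - t%:Z by lia.
  rewrite Mpt andbT; apply: contra Mp => /closed_s.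
  by rewrite addrK.
rewrite Mpt; have -> : p - t%:Z - N%:Z = p - N%:Z - t%:Z by lia.
exact: closed_t.
Qed.

Lemma corner_iter p n : corner N M p -> corner N M (iter n (next_corner M) p).
Proof. by move=> cp; elim: n => //= n; exact: corner_next. Qed.

Lemma iter_next_corner_period p : corner N M p -> iter N (next_corner M) p = p.
Proof.
move=> cp; apply: corner_inj => //; first exact: corner_iter.
have := dvdz_iter_next_corner M p N.
by rewrite opprD addrA rpredBr // dvdz_mulr.
Qed.

Lemma mem_traject_corners p q : corner N M p ->
  (q \in traject (next_corner M) p N) = corner N M q.
Proof.
move=> cp; apply/idP/idP => [/trajectP[k _ ->]|cq]; first exact: corner_iter.
have [k kN qk] := exists_class_index (q - p); apply/trajectP; exists k => //.
apply: corner_inj => //; first exact: corner_iter.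
rewrite -(rpredDr _ (dvdz_iter_next_corner M p k)).
by rewrite addrA subrK opprD addrA.
Qed.

Lemma traject_corners_uniq p : uniq (traject (next_corner M) p N).
Proof.
apply/(uniqP p) => k l; rewrite !inE size_traject => kN lN.
rewrite !nth_traject // => eq_kl; apply: class_index_inj => //.
have -> : k%:Z * s%:Z - l%:Z * s%:Z =
    iter l (next_corner M) p - (p + l%:Z * s%:Z)
    - (iter k (next_corner M) p - (p + k%:Z * s%:Z)) by rewrite eq_kl; ring.
by rewrite rpredB // dvdz_iter_next_corner.
Qed.

Lemma mem_words_corner_word p : corner N M p -> corner_word M p N \in words t s.
Proof.
move=> cp; rewrite mem_words; set w := corner_word _ _ _.
have closed_walk : displacement w = 0.
  by apply: (addrI p); rewrite addr0 -iter_next_corner iter_next_corner_period.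
have := count_letters w; rewrite size_corner_word.
move: closed_walk; rewrite /displacement.
by move: (count_mem _ _) (count_mem _ _) => i j; nia.
Qed.

Lemma exists_corner m :
  exists q, [/\ corner N M q, (N %| m - q)%Z & q <= (N * s)%N].
Proof.
have [k kN mk] := exists_class_index m.
have mod_iter := dvdz_iter_next_corner M 0 k; rewrite add0r in mod_iter.
exists (iter k (next_corner M) 0); split; first exact/corner_iter/corner0.
  by rewrite -(rpredDr _ mod_iter) addrA subrK.
have iter_le : iter k (next_corner M) 0 <= (k * s)%N.
  elim: (k) => //= l; move: (iter l _ _) => q ql.
  by rewrite /next_corner /step mulSn; case: ifP; lia.
by nia.
Qed.

Lemma ideal_bounded m : M m -> m < (N * s)%N.
Proof.
have [q [cq mq q_le]] := exists_corner m.
by rewrite (ideal_lt_corner cq mq); lia.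
Qed.

End Ideal.

Lemma eq_ideal M M' : ideal s t M -> ideal s t M' ->
  corner N M =1 corner N M' -> M =1 M'.
Proof.
move=> idealM idealM' eq_corner m; have [q [cq mq _]] := exists_corner idealM m.
rewrite (ideal_lt_corner idealM cq mq) (ideal_lt_corner idealM' _ mq) //.
by rewrite -eq_corner.
Qed.

(* The corners determine the ideal, and their minimum is 0. *)
Lemma corner_word_inj M M' p p' : ideal s t M -> ideal s t M' ->
    corner N M p -> corner N M' p' ->
  corner_word M p N = corner_word M' p' N -> p = p' /\ M =1 M'.
Proof.
move=> idealM idealM' cp cp' eq_word.
have shift q : corner N M (p + q) = corner N M' (p' + q).
  rewrite -(mem_traject_corners idealM _ cp).
  rewrite -(mem_traject_corners idealM' _ cp').
  by rewrite -!walk_corner_word eq_word !mem_walk.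
have pp' : p = p'.
  have := shift (- p); rewrite subrr corner0 // => /esym/(corner_ge0 idealM').
  have := shift (- p'); rewrite subrr corner0 // => /(corner_ge0 idealM).
  by lia.
split=> //; apply: eq_ideal => // q.
by have := shift (q - p); rewrite pp' !(addrC p') !subrK.
Qed.

(** * The ideal of a word *)

Section IdealOfWord.

Variable w : seq bool.
Hypothesis w_in : w \in words t s.

Lemma size_word : size w = N.
Proof.
by move: w_in; rewrite mem_words -count_letters => /andP[/eqP-> /eqP->]; lia.
Qed.

Lemma displacement_word : displacement w = 0.
Proof.
move: w_in; rewrite mem_words /displacement => /andP[/eqP-> /eqP->].
by rewrite mulrC subrr.
Qed.

Lemma walk_inj p q r :
  q \in walk p w -> r \in walk p w -> (N %| q - r)%Z -> q = r.
Proof.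
move=> /(nthP 0)[k]; rewrite size_walk size_word => kN <-.
move=> /(nthP 0)[l]; rewrite size_walk size_word => lN <- kl.
congr nth; apply: class_index_inj => //.
have -> : k%:Z * s%:Z - l%:Z * s%:Z =
    nth 0 (walk p w) k - nth 0 (walk p w) l
    + (nth 0 (walk p w) l - (p + l%:Z * s%:Z))
    - (nth 0 (walk p w) k - (p + k%:Z * s%:Z)) by ring.
have mod_nth n : (n < N)%N -> (N %| nth 0 (walk p w) n - (p + n%:Z * s%:Z))%Z.
  by move=> nN; apply: dvdz_nth_walk; rewrite size_word.
by apply: rpredB (mod_nth k kN); apply: rpredD (mod_nth l lN).
Qed.

Lemma walk_class p m : exists2 q, q \in walk p w & (N %| m - q)%Z.
Proof.
have [k kN mk] := exists_class_index (m - p); exists (nth 0 (walk p w) k).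
  by rewrite mem_nth // size_walk size_word.
have kw : (k < size w)%N by rewrite size_word.
rewrite -(rpredDr _ (dvdz_nth_walk p kw)) addrA subrK.
by rewrite opprD addrA.
Qed.

Lemma perm_walk_ends p :
  perm_eq [seq x.1 + step x.2 | x <- zip (walk p w) w] (walk p w).
Proof.
by rewrite -(perm_cons p) cons_walk_ends displacement_word addr0 perm_rcons.
Qed.

Lemma walk_succ p q b : (q, b) \in zip (walk p w) w -> q + step b \in walk p w.
Proof.
move=> qb; rewrite -(perm_mem (perm_walk_ends p)).
exact: (map_f (fun x => x.1 + step x.2) qb).
Qed.

Lemma walk_pred p q : q \in walk p w ->
  exists b, q - step b \in walk p w.
Proof.
rewrite -{1}(perm_mem (perm_walk_ends p)) => /mapP[[r b] rb ->]; exists b.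
rewrite addrK -[walk p w](unzip1_zip (t := w)) ?size_walk //.
exact: (map_f fst rb).
Qed.

Lemma walk_letter p q : q \in walk p w -> exists b, (q, b) \in zip (walk p w) w.
Proof.
rewrite -{1}[walk p w](unzip1_zip (t := w)) ?size_walk // => /mapP[[r b] rb ->].
by exists b.
Qed.

Definition word_ideal p : pred int :=
  fun m => has (fun q => (m < q) && (N %| m - q)%Z) (walk p w).

Lemma word_idealE p m q :
  q \in walk p w -> (N %| m - q)%Z -> word_ideal p m = (m < q).
Proof.
move=> qw mq; apply/hasP/idP => [[r rw /andP[mr mr_mod]]|mq_lt].
  rewrite (walk_inj qw rw) //.
  have -> : q - r = m - r - (m - q) by ring.
  exact: rpredB.
by exists q; rewrite ?mq_lt.
Qed.

Lemma step_closed_word_ideal_s p : step_closed s (word_ideal p).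
Proof.
move=> m /hasP[q qw /andP[mq mq_mod]].
have [b] := walk_pred qw; set r := q - step b => rw.
have mr_mod : (N %| m - s%:Z - r)%Z.
  have -> : m - s%:Z - r = m - q + (step b - s%:Z) by rewrite /r; ring.
  exact: rpredD (dvdz_step b).
rewrite (word_idealE rw mr_mod) /r; case: b {rw r mr_mod}; rewrite /step; lia.
Qed.

Lemma step_closed_word_ideal_t p : step_closed t (word_ideal p).
Proof.
move=> m /hasP[q qw /andP[mq mq_mod]].
have [b /walk_succ rw] := walk_letter qw.
have mr_mod : (N %| m - t%:Z - (q + step b))%Z.
  have -> : m - t%:Z - (q + step b) = m - q - (step b - s%:Z) - N%:Z by lia.
  by apply: rpredB (dvdzz _); apply: rpredB (dvdz_step b).
by rewrite (word_idealE rw mr_mod); case: b {rw mr_mod}; rewrite /step; lia.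
Qed.

Lemma ideal_word_ideal p : 0 \in walk p w ->
  (forall q, q \in walk p w -> 0 <= q) -> ideal s t (word_ideal p).
Proof.
move=> w0 w_ge0; split; first exact: step_closed_word_ideal_s.
- exact: step_closed_word_ideal_t.
- move=> m m0; have [q qw mq] := walk_class p m.
  by rewrite (word_idealE qw mq) (lt_le_trans m0) ?w_ge0.
- by rewrite (word_idealE w0) ?subrr ?dvdz0.
Qed.

Lemma mem_walk_corner p q : q \in walk p w -> corner N (word_ideal p) q.
Proof.
move=> qw; have mod_q : (N %| q - N%:Z - q)%Z.
  by rewrite addrAC subrr sub0r rpredN dvdzz.
rewrite /corner (word_idealE qw mod_q) (word_idealE qw) ?subrr ?dvdz0 //.
by lia.
Qed.

Lemma word_ideal_letter p q b : (q, b) \in zip (walk p w) w ->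
  word_ideal p (q - t%:Z) = b.
Proof.
move=> /walk_succ rw; have mod_r : (N %| q - t%:Z - (q + step b))%Z.
  have -> : q - t%:Z - (q + step b) = - (step b - s%:Z) - N%:Z by lia.
  by apply: rpredB (dvdzz _); rewrite rpredN dvdz_step.
by rewrite (word_idealE rw mod_r); case: b {rw mod_r}; rewrite /step; lia.
Qed.

Lemma corner_word_word_ideal p : corner_word (word_ideal p) p N = w.
Proof.
rewrite -size_word; apply: corner_word_eq => -[q b].
exact: word_ideal_letter.
Qed.

Lemma exists_walk_min0 :
  exists2 p, 0 \in walk p w & forall q, q \in walk p w -> 0 <= q.
Proof.
have size_gt0 : (0 < size w)%N by rewrite size_word; lia.
pose x (k : 'I_(size w)) := nth 0 (walk 0 w) k.
have [k _ k_min] := @arg_minP _ _ _ (Ordinal size_gt0) xpredT x isT.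
exists (- x k) => [|q].
  by rewrite -(addNr (x k)) mem_walk mem_nth // size_walk.
rewrite -[q](addKr (x k)) mem_walk => /(nthP 0)[l]; rewrite size_walk => lw <-.
by rewrite addrC subr_ge0; exact: (k_min (Ordinal lw)).
Qed.

Lemma exists_ideal_of_word : exists M p,
  [/\ ideal s t M, corner N M p & corner_word M p N = w].
Proof.
have [p w0 w_ge0] := exists_walk_min0; exists (word_ideal p), p; split.
- exact: ideal_word_ideal.
- apply: mem_walk_corner; have := size_word; case: (w) => //=; first by lia.
  by move=> b w' _; exact: mem_head.
- exact: corner_word_word_ideal.
Qed.

End IdealOfWord.

End Corners.

(** * The variance of the rises of a walk *)

Section Crossings.

Implicit Types (w : seq bool) (p : int).

Local Notation "'#t' w" := (count_mem true w)%:Z (at level 10).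
Local Notation "'#f' w" := (count_mem false w)%:Z (at level 10).
Local Notation tf := (subcount [:: true; false]).
Local Notation ft := (subcount [:: false; true]).
Local Notation tft := (subcount [:: true; false; true]).
Local Notation ftf := (subcount [:: false; true; false]).

Lemma subcount1 (b : bool) w : subcount [:: b] w = count_mem b w.
Proof. by elim: w => //= a w ->; rewrite muln1 addnC eq_sym. Qed.

Lemma subcount_tf w : (tf w)%:Z = #t w * #f w - (ft w)%:Z.
Proof.
elim: w => // b w IHw; rewrite !subcount_cons !subcount1.
by case: b => /=; rewrite !(mul0n, mul1n, add0n, addn0) !PoszD IHw; ring.
Qed.

Lemma crossing_countE w :
  (crossing_count w)%:Z = (ft w)%:Z ^+ 2 + #t w * (ftf w)%:Z
    + #f w * (tft w)%:Z - #t w * #f w * (ft w)%:Z.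
Proof.
rewrite /crossing_count; elim: w => // b w IHw.
rewrite !subcount_cons !subcount1 addnACA PoszD IHw.
by case: b => /=;
  rewrite !(mul0n, mul1n, add0n, addn0) !PoszD ?subcount_tf; ring.
Qed.

Variables s t : nat.

Definition rises p w : seq int := mask w (walk s t p w).

Lemma rises_cons p b w :
  rises p (b :: w) = nseq b p ++ rises (p + step s t b) w.
Proof. by case: b. Qed.

Lemma sum_rises p w :
  2 * \sum_(x <- rises p w) x =
  2 * p * #t w + s%:Z * #t w * (#t w - 1) - 2 * t%:Z * (ft w)%:Z.
Proof.
elim: w p => [|b w IHw] p; first by rewrite big_nil /=; ring.
rewrite !subcount_cons !subcount1 rises_cons big_cat mulrDr IHw.
by case: b; rewrite ?big_seq1 ?big_nil /= !(mul0n, mul1n, addn0) !PoszD; ring.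
Qed.

Lemma sum_sqr_rises p w :
  6 * \sum_(x <- rises p w) x ^+ 2 =
  6 * p ^+ 2 * #t w
  + 6 * p * (s%:Z * #t w * (#t w - 1) - 2 * t%:Z * (ft w)%:Z)
  + s%:Z ^+ 2 * #t w * (#t w - 1) * (2 * #t w - 1)
  - 6 * s%:Z * t%:Z * ((tft w)%:Z + (#t w - 1) * (ft w)%:Z)
  + 6 * t%:Z ^+ 2 * (#f w * (ft w)%:Z - (ftf w)%:Z).
Proof.
elim: w p => [|b w IHw] p; first by rewrite big_nil /=; ring.
rewrite !subcount_cons !subcount1 rises_cons big_cat mulrDr IHw.
by case: b; rewrite ?big_seq1 ?big_nil /=;
  rewrite !(mul0n, mul1n, addn0) !PoszD ?subcount_tf; ring.
Qed.

Lemma variance_rises p w : w \in words t s ->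
  12 * (t%:Z * \sum_(x <- rises p w) x ^+ 2
        - (\sum_(x <- rises p w) x) ^+ 2) =
  t%:Z ^+ 2 * (s%:Z ^+ 2 * (t%:Z ^+ 2 - 1) - 12 * (crossing_count w)%:Z).
Proof.
rewrite mem_words => /andP[/eqP wt /eqP ws].
transitivity (2 * t%:Z * (6 * \sum_(x <- rises p w) x ^+ 2)
  - 3 * (2 * \sum_(x <- rises p w) x) ^+ 2); first by ring.
by rewrite sum_rises sum_sqr_rises crossing_countE wt ws; ring.
Qed.

End Crossings.

(** * Beta sets *)

Section BetaSets.

Implicit Types (la : intpart) (b u : nat).

Definition betas la : seq nat := [seq beta la i | i <- iota 1 (size la)].

Lemma size_betas la : size (betas la) = size la.
Proof. by rewrite size_map size_iota. Qed.

Lemma nth_betas la i : (i < size la)%N ->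
  nth 0%N (betas la) i = (nth 0%N la i + (size la - i.+1))%N.
Proof.
move=> ik; rewrite (nth_map 0%N) ?size_iota // nth_iota // /beta /part add1n /=.
by lia.
Qed.

Lemma betasP la b : reflect (in_beta la b) (b \in betas la).
Proof.
apply: (iffP mapP) => -[i i_row ->]; exists i => //.
  by move: i_row; rewrite mem_iota; lia.
by rewrite mem_iota; lia.
Qed.

Lemma betas_gt0 la b : b \in betas la -> (0 < b)%N.
Proof.
by move=> /betasP[i i_row ->]; have := Defs.part_gt0 i_row; rewrite /beta; lia.
Qed.

Lemma betas_sorted la : sorted gtn (betas la).
Proof.
apply/(sortedP 0%N) => i; rewrite size_betas => ik.
rewrite /= !nth_betas //; last exact: ltnW.
by have := @part_mono la i.+1 i.+2 isT (leqnSn _); rewrite /part /=; lia.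
Qed.

Lemma betas_uniq la : uniq (betas la).
Proof. by have := betas_sorted la; rewrite gtn_sorted_uniq_geq => /andP[]. Qed.

Lemma betas_inj la la' : betas la =i betas la' -> la = la'.
Proof.
move=> eq_mem; have eq_betas : betas la = betas la'.
  by apply: (irr_sorted_eq (rev_trans ltn_trans) ltnn) eq_mem;
    rewrite betas_sorted.
have eq_size : size la = size la' by rewrite -!size_betas eq_betas.
apply: val_inj; apply: (@eq_from_nth _ 0%N) => //= i ik.
by have := nth_betas ik; rewrite eq_betas nth_betas -?eq_size //; lia.
Qed.

Lemma leq_nth_sorted_gtn (bs : seq nat) i : sorted gtn bs -> all (leq 1) bs ->
  (i < size bs)%N -> (size bs - i <= nth 0%N bs i)%N.
Proof.
elim: bs i => // a [|b bs] IH i /=.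
  by move=> _ /andP[a0 _]; case: i => //= _; lia.
move=> /andP[ab sb] /andP[a0 ab0]; case: i => [|i] ik /=.
  by have := IH 0%N sb ab0 isT; rewrite /=; lia.
exact: IH.
Qed.

Lemma betas_surj (bs : seq nat) : sorted gtn bs -> all (leq 1) bs ->
  exists la, betas la = bs.
Proof.
move=> bs_sorted bs_gt0; pose k := size bs.
pose parts := mkseq (fun i => nth 0%N bs i - (k - i.+1))%N k.
have bs_ge i : (i < k)%N -> (k - i <= nth 0%N bs i)%N.
  exact: leq_nth_sorted_gtn bs_sorted bs_gt0.
have parts_partition : is_partition parts.
  apply/andP; split.
    apply/(sortedP 0%N) => i; rewrite size_mkseq => ik.
    rewrite /= !nth_mkseq //; last exact: ltnW.
    by have /= := sortedP 0%N bs_sorted i ik; lia.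
  apply/(all_nthP 0%N) => i; rewrite size_mkseq => ik.
  by rewrite nth_mkseq //; have := bs_ge i ik; lia.
exists (IntPart parts_partition); apply: (@eq_from_nth _ 0%N).
  by rewrite size_betas /= size_mkseq.
move=> i; rewrite size_betas /= size_mkseq => ik.
by rewrite nth_betas /= size_mkseq // nth_mkseq //; have := bs_ge i ik; lia.
Qed.

Lemma sum_betas la :
  (\sum_(b <- betas la) b = psize la + 'C(size la, 2))%N.
Proof.
rewrite (big_nth 0%N) size_betas /psize sumnE [in RHS](big_nth 0%N).
rewrite -bin2_sum [X in (_ + X)%N]big_nat_rev -big_split /=.
rewrite !big_nat; apply: eq_bigr => i /andP[_ ik].
by rewrite nth_betas // add0n.
Qed.

Lemma ltn_count_leq (bs : seq nat) i j : (0 < j)%N -> sorted geq bs ->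
  (i < count (leq j) bs)%N = (j <= nth 0 bs i)%N.
Proof.
move=> j0; elim: bs i => [|b bs IHbs] i /=; first by rewrite nth_nil; lia.
rewrite (path_sortedE (rev_trans leq_trans)) => /andP[/allP bs_le bs_sorted].
have [jb|bj] := leqP j b.
  by case: i => [|i] /=; rewrite ?jb // add1n ltnS IHbs.
have nth_lt k : (nth 0 bs k < j)%N.
  have [k_bs|bs_k] := ltnP k (size bs); last by rewrite nth_default.
  by have /= := bs_le _ (mem_nth 0%N k_bs); lia.
rewrite add0n IHbs //.
by case: i => [|i] /=; rewrite !(leqNgt j) nth_lt ?bj ?nth_lt.
Qed.

Lemma leq_conj_part la i j : (0 < i)%N -> (0 < j)%N ->
  (i <= conj_part la j)%N = (j <= part la i)%N.
Proof.
case: i => // i _ j0; have /andP[la_sorted _] := valP la.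
exact: ltn_count_leq.
Qed.

Lemma is_core_betas u la : is_core u la <->
  (forall b, b \in betas la -> (u <= b)%N -> (b - u)%N \in betas la).
Proof.
split=> [core b /betasP bla ub|closed i j [ila jla] hook].
  by apply/betasP; exact: in_betaB core bla ub.
set c := conj_part la j.
have row k : (0 < k)%N -> (k <= c)%N = (j <= part la k)%N.
  by move=> k0; rewrite leq_conj_part //; lia.
have beta_i : beta la i \in betas la by apply/betasP; exists i.
have c_size : (c <= size la)%N by exact: count_size.
have ic : (i <= c)%N by rewrite row; lia.
have hookE : hook_length la i j = (part la i - j + (c - i) + 1)%N by [].
have /betasP[k k_row] : (size la + j - c - 1)%N \in betas la.
  have -> : (size la + j - c - 1 = beta la i - u)%N by rewrite /beta; lia.
  by apply: closed => //; rewrite /beta; lia.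
by have := row k; rewrite /beta; lia.
Qed.

End BetaSets.

(** * The ideal and the size of a core *)

Section CoreIdeals.

Implicit Types (la : intpart) (s t u : nat) (m : int).

Definition beta_ideal la : pred int :=
  fun m => (m < 0) || (`|m|%N \in betas la).

Lemma beta_idealE la (b : nat) : beta_ideal la b = (b \in betas la).
Proof. by []. Qed.

Lemma beta_ideal0 la : ~~ beta_ideal la 0.
Proof. by rewrite beta_idealE; apply/negP => /betas_gt0. Qed.

Lemma beta_ideal_inj la la' : beta_ideal la =1 beta_ideal la' -> la = la'.
Proof. by move=> eq_ideal; apply: betas_inj => b; exact: eq_ideal b%:Z. Qed.

Lemma is_core_step_closed u la : (0 < u)%N ->
  is_core u la <-> step_closed u (beta_ideal la).
Proof.
move=> u_gt0; rewrite is_core_betas; split=> [closed [b|b]|closed b bla ub].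
- rewrite beta_idealE => bla; have [ub|bu] := leqP u b.
    by rewrite subzn // beta_idealE; exact: closed.
  by apply/orP; left; lia.
- by move=> _; apply/orP; left; lia.
by rewrite -beta_idealE -subzn //; exact: closed.
Qed.

Lemma cores_ideal s t la : (0 < s)%N -> (0 < t)%N ->
  cores s t la <-> ideal s t (beta_ideal la).
Proof.
move=> s_gt0 t_gt0; have closed_s := is_core_step_closed la s_gt0.
have closed_t := is_core_step_closed la t_gt0.
split=> [[/closed_s core_s /closed_t core_t]|]; last first.
  by move=> [/closed_s core_s /closed_t core_t].
by split=> // [m m0|]; [apply/orP; left | exact: beta_ideal0].
Qed.

Lemma core_of_ideal s t M : (0 < s)%N -> (0 < t)%N -> coprime s t ->
  ideal s t M -> exists2 la, cores s t la & beta_ideal la =1 M.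
Proof.
move=> s_gt0 t_gt0 st_coprime idealM; have [_ _ neg M0] := idealM.
pose bs := rev [seq b <- iota 1 ((s + t) * s) | M b%:Z].
have [||la betas_la] := @betas_surj bs.
- rewrite rev_sorted; apply: sorted_filter (iota_ltn_sorted _ _).
  exact: ltn_trans.
- rewrite all_rev; apply/allP => b; rewrite mem_filter mem_iota.
  by case/and3P.
have eqM : beta_ideal la =1 M.
  case=> b; last by rewrite neg //; apply/orP; left; lia.
  rewrite beta_idealE betas_la mem_rev mem_filter mem_iota.
  case: (boolP (M b)) => //= Mb.
  have := ideal_bounded s_gt0 t_gt0 st_coprime idealM Mb.
  by case: b Mb => [|b] Mb; [rewrite Mb in M0 | lia].
exists la => //; apply/cores_ideal => //; case: idealM => closed_s closed_t _ _.
split=> [m|m|m m0|]; rewrite ?eqM //; first exact: closed_s.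
  exact: closed_t.
exact: neg.
Qed.

Lemma perm_betas_corners u la (P : seq int) :
    step_closed u (beta_ideal la) -> uniq P ->
    P =i corner u (beta_ideal la) ->
  perm_eq ([seq b%:Z | b <- betas la] ++ P)
    ([seq r%:Z | r <- iota 0 u] ++ [seq b%:Z + u%:Z | b <- betas la]).
Proof.
move=> closed uniqP memP; set M := beta_ideal la in closed memP.
have Posz_inj : injective Posz by move=> a b [].
have memB x : (x \in [seq b%:Z | b <- betas la]) = (0 <= x) && M x.
  case: x => [b|b]; first by rewrite mem_map.
  by rewrite [RHS](_ : _ = false) //; apply/mapP => -[].
have memI x : (x \in [seq r%:Z | r <- iota 0 u]) = (0 <= x < u%:Z).
  case: x => [b|b]; first by rewrite mem_map // mem_iota.
  by rewrite [RHS](_ : _ = false) //; apply/mapP => -[].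
have memBu x : (x \in [seq b%:Z + u%:Z | b <- betas la]) =
    (u%:Z <= x) && M (x - u%:Z).
  rewrite -subr_ge0 -memB -[in RHS](mem_map (addIr u%:Z)) -[in RHS]map_comp.
  by rewrite subrK.
apply: uniq_perm.
- rewrite cat_uniq uniqP map_inj_uniq // betas_uniq andbT /=.
  by apply/hasPn => x; rewrite memP memB => /andP[/negPf-> _]; rewrite andbF.
- rewrite cat_uniq map_inj_uniq // iota_uniq.
  rewrite map_inj_uniq ?betas_uniq ?andbT => [|a b /addIr/Posz_inj //].
  by apply/hasPn => x; rewrite memBu memI => /andP[ux _]; lia.
move=> x; rewrite !mem_cat memB memP memI memBu unfold_in /corner -/M.
have neg m : m < 0 -> M m by move=> m0; apply/orP; left.
have [x0|x0] := ltP x 0.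
  by rewrite neg //=; case: (leP u%:Z x) => //; lia.
have [xu|ux] := ltP x u%:Z.
  by rewrite [M (x - u%:Z)]neg ?andbT ?orbN //; lia.
by case: (boolP (M x)) => //= /closed->.
Qed.

Lemma sum_iota (u : nat) :
  2 * \sum_(r <- iota 0 u) r%:Z = u%:Z * (u%:Z - 1).
Proof.
elim: u => [|u IHu]; first by rewrite big_nil.
by rewrite -(addn1 u) iotaD big_cat big_seq1 mulrDr IHu; lia.
Qed.

Lemma sum_sqr_iota (u : nat) :
  6 * \sum_(r <- iota 0 u) r%:Z ^+ 2 = u%:Z * (u%:Z - 1) * (2 * u%:Z - 1).
Proof.
elim: u => [|u IHu]; first by rewrite big_nil.
by rewrite -(addn1 u) iotaD big_cat big_seq1 mulrDr IHu PoszD; ring.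
Qed.

Lemma sum_corners u la (P : seq int) (f : int -> int) :
    step_closed u (beta_ideal la) -> uniq P ->
    P =i corner u (beta_ideal la) ->
  \sum_(x <- P) f x =
  \sum_(r <- iota 0 u) f r%:Z
  + \sum_(b <- betas la) (f (b%:Z + u%:Z) - f b%:Z).
Proof.
move=> closed uniqP memP.
have eq_sum : \sum_(x <- [seq b%:Z | b <- betas la] ++ P) f x =
    \sum_(x <- [seq r%:Z | r <- iota 0 u]
               ++ [seq b%:Z + u%:Z | b <- betas la]) f x.
  exact/perm_big/perm_betas_corners.
rewrite sumrB; move: (betas la) eq_sum => bs; rewrite !big_cat !big_map /=.
move=> eq_sum; apply: (addrI (\sum_(b <- bs) f b%:Z)).
by rewrite eq_sum; ring.
Qed.

Lemma core_size_corners u la (P : seq int) :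
    step_closed u (beta_ideal la) -> uniq P ->
    P =i corner u (beta_ideal la) ->
  12 * (u%:Z * \sum_(x <- P) x ^+ 2 - (\sum_(x <- P) x) ^+ 2) =
  u%:Z ^+ 2 * (24 * (psize la)%:Z + u%:Z ^+ 2 - 1).
Proof.
move=> closed uniqP memP.
set k := size la.
have sum_P : 2 * \sum_(x <- P) x = u%:Z * (u%:Z - 1) + 2 * (k%:Z * u%:Z).
  rewrite (sum_corners id closed) // mulrDr sum_iota; congr (_ + 2 * _).
  under eq_bigr do rewrite /= addrAC subrr add0r.
  by rewrite big_const_seq count_predT size_betas iter_addr_0 -mulr_natl natz.
have sum_bs : \sum_(b <- betas la) b%:Z = (psize la)%:Z + 'C(k, 2)%:Z.
  by rewrite -PoszD -sum_betas (big_morph Posz PoszD (erefl _)).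
have sum_sqr_P : 6 * \sum_(x <- P) x ^+ 2 = u%:Z * (u%:Z - 1) * (2 * u%:Z - 1)
    + 6 * (k%:Z * u%:Z ^+ 2 + 2 * u%:Z * ((psize la)%:Z + 'C(k, 2)%:Z)).
  rewrite (sum_corners (fun x => x ^+ 2) closed) // mulrDr sum_sqr_iota.
  congr (_ + 6 * _).
  transitivity (\sum_(b <- betas la) (u%:Z ^+ 2 + 2 * u%:Z * b%:Z)).
    by apply: eq_bigr => b _; ring.
  rewrite big_split; congr (_ + _); last by rewrite -mulr_sumr sum_bs.
  by rewrite big_const_seq count_predT size_betas iter_addr_0 -mulr_natl natz.
have bin2_size : 2 * 'C(k, 2)%:Z = k%:Z * (k%:Z - 1).
  have := mul_bin_diag k 1; rewrite bin1; case: (k) => [|l] //=; lia.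
transitivity (2 * u%:Z * (6 * \sum_(x <- P) x ^+ 2)
  - 3 * (2 * \sum_(x <- P) x) ^+ 2); first by ring.
rewrite sum_P sum_sqr_P.
transitivity (u%:Z ^+ 2 * (24 * (psize la)%:Z + 12 * (2 * 'C(k, 2)%:Z)
  + 12 * k%:Z - 12 * k%:Z ^+ 2 + u%:Z ^+ 2 - 1)); first by ring.
by rewrite bin2_size; ring.
Qed.

End CoreIdeals.

(** * Cores and words *)

Section CoreWords.

Variables s t : nat.
Hypotheses (s_gt0 : (0 < s)%N) (t_gt0 : (0 < t)%N) (st_coprime : coprime s t).

Implicit Types (la : intpart) (p : int).

Local Notation N := (s + t)%N.

Definition core_corners la : seq int :=
  traject (next_corner s t (beta_ideal la)) 0 N.

Definition core_word la p : seq bool := corner_word s t (beta_ideal la) p N.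

Lemma mem_core_corners la p : cores s t la ->
  (p \in core_corners la) = corner N (beta_ideal la) p.
Proof.
move=> /(cores_ideal la s_gt0 t_gt0) idealM.
exact/mem_traject_corners/corner0.
Qed.

Lemma mem_words_core_word la p : cores s t la -> p \in core_corners la ->
  core_word la p \in words t s.
Proof.
move=> core; rewrite mem_core_corners //.
by apply: mem_words_corner_word => //; exact/cores_ideal.
Qed.

(* The [true] letters of the word sit at the corners for [t]. *)
Lemma core_size_crossings la p : cores s t la -> p \in core_corners la ->
  24 * (psize la)%:Z + 12 * (crossing_count (core_word la p))%:Z =
  (s%:Z ^+ 2 - 1) * (t%:Z ^+ 2 - 1).
Proof.
move=> core p_corner; have idealM := (cores_ideal la s_gt0 t_gt0).1 core.
set M := beta_ideal la in idealM *; have [closed_s closed_t _ _] := idealM.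
have cp : corner N M p by rewrite -mem_core_corners.
set P := rises s t p (core_word la p).
have PE : P = [seq q <- traject (next_corner s t M) p N | M (q - t%:Z)].
  by rewrite filter_mask /P /rises walk_corner_word.
have := variance_rises p (mem_words_core_word core p_corner); rewrite -/P.
rewrite (@core_size_corners t la P) //; first by nia.
  by rewrite PE filter_uniq // traject_corners_uniq.
move=> q; rewrite PE mem_filter mem_traject_corners //.
rewrite unfold_in /corner -/M andbC.
have [/closed_s|_] := boolP (M (q - t%:Z)); last by rewrite !andbF.
have -> : q - t%:Z - s%:Z = q - N%:Z by lia.
by move=> ->; rewrite !andbT.
Qed.

Lemma perm_core_words :
  perm_eq
    [seq core_word la p | la <- fset_set (cores s t), p <- core_corners la]
    (words t s).
Proof.
have mem_coresE la : (la \in fset_set (cores s t)) <-> cores s t la.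
  by rewrite in_fset_set ?inE //; exact: finite_cores.
apply: uniq_perm; last 1 first.
- move=> w; apply/allpairsPdep/idP.
    move=> [la [p [/mem_coresE core p_corner ->]]].
    exact: mem_words_core_word.
  move=> /(exists_ideal_of_word s_gt0 t_gt0 st_coprime)[M [p [idealM cp <-]]].
  have [la core eqM] := core_of_ideal s_gt0 t_gt0 st_coprime idealM.
  have {}eqM : beta_ideal la = M by exact: funext.
  exists la, p; split; first exact/mem_coresE.
    by rewrite mem_core_corners // eqM.
  by rewrite /core_word eqM.
- apply: allpairs_uniq_dep => [|la _|]; first exact: fset_uniq.
    exact: traject_corners_uniq.
  move=> _ _ /allpairsPdep[la [p [/mem_coresE core p_corner ->]]]
    /allpairsPdep[la' [p' [/mem_coresE core' p_corner' ->]]] /= eq_word.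
  rewrite !mem_core_corners // in p_corner p_corner'.
  have idealM := (cores_ideal la s_gt0 t_gt0).1 core.
  have idealM' := (cores_ideal la' s_gt0 t_gt0).1 core'.
  have [-> /beta_ideal_inj-> //] := corner_word_inj s_gt0 t_gt0 st_coprime
    idealM idealM' p_corner p_corner' eq_word.
- exact: words_uniq.
Qed.

Lemma expect_cores (F : rat -> rat) :
  expect (cores s t) (fun la => F (psize la)%:R) =
  mean (words t s) (fun w =>
    F ((s%:R ^+ 2 - 1) * (t%:R ^+ 2 - 1) / 24
       + (- 2^-1) * (crossing_count w)%:R)).
Proof.
have sizes : {in fset_set (cores s t), forall la, size (core_corners la) = N}.
  by move=> la _; rewrite size_traject.
rewrite -(perm_mean _ perm_core_words) (mean_allpairs_dep _ _ sizes).
apply: eq_in_mean => la; rewrite in_fset_set ?inE; last exact: finite_cores.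
move=> core; rewrite -[LHS](@mean_cst _ _ (core_corners la)); last first.
  by rewrite size_traject; lia.
apply: eq_in_mean => p p_corner; congr F.
have := core_size_crossings core p_corner.
move: (crossing_count _) => Y /(congr1 (fun z : int => z%:~R : rat)).
rewrite !(rmorphD, rmorphB, rmorphM, rmorphXn) /= => sizeE.
by rewrite -sizeE; field.
Qed.

End CoreWords.

Theorem theorem3 (s t : nat) (hs : (0 < s)%N) (ht : (0 < t)%N)
    (hst : coprime s t) :
  let X := fun la : intpart => (psize la)%:R : rat in
  let S : rat := s%:R in
  let T : rat := t%:R in
  expect (cores s t) (fun la => (X la - expect (cores s t) X) ^+ 3) =
    1 / (60 * 1000 + 480) * S * T * (T - 1) * (S - 1) * (S + T + 1) * (S + T) *
      (2 * S ^+ 2 * T + 2 * S * T ^+ 2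
        - 3 * S ^+ 2 - 3 * S * T - 3 * T ^+ 2 - 3).
Proof.
move=> X S T.
rewrite (expect_cores hs ht hst id).
rewrite (expect_cores hs ht hst (fun x => (x - _) ^+ 3)).
rewrite (central_moment3_affine _ _ _ (size_words_neq0 t s)).
rewrite (central_moment3_crossings rat t s).
by rewrite -/S -/T; field.
Qed.
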